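(* Let $\lambda$ be a nonzero real number, let $r\ge 0$ be an integer and let $m\ge 1$ be an integer. For all integers $n,k\ge 0$ with $n\ge k$, $$\frac{{n+r \brace k+r}_{r,\lambda}}{\binom{k+m}{k}}=\sum_{l=k}^{n}\frac{\binom{n}{l}}{\binom{l+m}{l}}{l+m \brace k+m}_{\lambda}B_{n-l}^{(m)}\Big(\frac{r}{\lambda}\Big)\lambda^{n-l}.$$
   Context: For a nonzero real $\lambda$, the generalized falling factorials are $(x)_{0,\lambda}=1$ and $(x)_{n,\lambda}=x(x-\lambda)\cdots(x-(n-1)\lambda)$ for $n\ge 1$. The $\lambda$-analogues of Stirling numbers of the second kind ${n \brace k}_{\lambda}$ and, for an integer $r\ge 0$, the $\lambda$-analogues of $r$-Stirling numbers of the second kind ${n+r \brace k+r}_{r,\lambda}$ ($0\le k\le n$) are the real numbers uniquely determined by the polynomial identities in $x$ $$x^{n}=\sum_{k=0}^{n}{n \brace k}_{\lambda}(x)_{k,\lambda},\qquad (x+r)^{n}=\sum_{k=0}^{n}{n+r \brace k+r}_{r,\lambda}(x)_{k,\lambda},\quad n\ge 0.$$ In particular ${l+m \brace k+m}_{\lambda}$ (with subscript $\lambda$ only) is the coefficient of $(x)_{k+m,\lambda}$ in the expansion of $x^{l+m}$. For an integer $m\ge 1$, the higher-order Bernoulli polynomials $B_n^{(m)}(x)$ are defined by $\big(\frac{t}{e^{t}-1}\big)^{m}e^{xt}=\sum_{n=0}^{\infty}B_{n}^{(m)}(x)\frac{t^{n}}{n!}$. *)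

(* Defs.v *)
From HB Require Import structures.
From mathcomp Require Import all_boot all_order all_algebra.
From mathcomp Require Import ring.

Set Implicit Arguments.
Unset Strict Implicit.
Unset Printing Implicit Defensive.
Import Order.TTheory GRing.Theory Num.Theory.
Local Open Scope ring_scope.

Section GeneralizedFallingFactorial.
Variable F : fieldType.
Implicit Types (lam : F) (n k r : nat) (S : nat -> nat -> F).

(* (x)_{n,lam} as a polynomial in x *)
Definition gffact lam n : {poly F} := \prod_(i < n) ('X - (i%:R * lam)%:P).

(* Only the values [S n k] with [k <= n] are constrained. *)
Definition is_lstirling2 lam S : Prop :=
  forall n, 'X^n = \sum_(k < n.+1) S n k *: gffact lam k.

(* [S] is indexed by the entries of the bracket symbol: [S (n + r) (k + r)] is
   {n+r brace k+r}_{r,lam}. Only these values with [k <= n] are constrained. *)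
Definition is_lrstirling2 lam r S : Prop :=
  forall n, ('X + r%:R%:P) ^+ n =
            \sum_(k < n.+1) S (n + r)%N (k + r)%N *: gffact lam k.

Lemma gffactS lam n :
  gffact lam n.+1 = gffact lam n * ('X - (n%:R * lam)%:P).
Proof. by rewrite /gffact big_ord_recr. Qed.

Lemma size_gffact lam n : size (gffact lam n) = n.+1.
Proof.
by rewrite /gffact size_prod_XsubC /index_enum -enumT size_enum_ord.
Qed.

Lemma gffact_free lam n (c : nat -> F) :
  \sum_(k < n) c k *: gffact lam k = 0 -> forall k, (k < n)%N -> c k = 0.
Proof.
elim: n => // n IHn; rewrite big_ord_recr /= => sum0.
have cn0 : c n = 0.
  have sz : (size (\sum_(k < n) c k *: gffact lam k)%R <= n)%N.
    apply: (leq_trans (size_sum _ _ _)); apply/bigmax_leqP => i _.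
    by apply: (leq_trans (size_scale_leq _ _)); rewrite size_gffact.
  apply/eqP; move: sum0 => /eqP; rewrite addr_eq0 => /eqP sumE.
  move: sz; rewrite sumE size_polyN; case: eqVneq => // cn0.
  by rewrite size_scale // size_gffact ltnn.
move: sum0; rewrite cn0 scale0r addr0 => /IHn sum0 k.
by rewrite ltnS leq_eqVlt => /orP[/eqP->|/sum0].
Qed.

Fixpoint gffact_coord lam (c : F) n k : F :=
  if n is n'.+1 then
    (if k is k'.+1 then gffact_coord lam c n' k' else 0)
      + (c + k%:R * lam) * gffact_coord lam c n' k
  else (k == 0%N)%:R.

Lemma gffact_coord_gt lam c n k : (n < k)%N -> gffact_coord lam c n k = 0.
Proof.
elim: n k => [|n IHn] [|k] //= nk.
by rewrite !IHn ?mulr0 ?addr0 // ltnW.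
Qed.

Lemma gffact_coordP lam c n :
  ('X + c%:P) ^+ n = \sum_(k < n.+1) gffact_coord lam c n k *: gffact lam k.
Proof.
elim: n => [|n IHn].
  by rewrite big_ord1 /= /gffact big_ord0 scale1r expr0.
rewrite exprSr IHn mulr_suml.
transitivity (\sum_(k < n.+1) gffact_coord lam c n k *: gffact lam k.+1
  + \sum_(k < n.+1) ((c + k%:R * lam) * gffact_coord lam c n k) *: gffact lam k).
  rewrite -big_split /=; apply: eq_bigr => k _.
  rewrite gffactS -!mul_polyC !polyCM polyCD polyCM; ring.
under [RHS]eq_bigr do rewrite /= scalerDl.
rewrite big_split /=; congr (_ + _).
  by rewrite [RHS]big_ord_recl scale0r add0r.
by rewrite [RHS]big_ord_recr /= gffact_coord_gt // mulr0 scale0r addr0.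
Qed.

Lemma lrstirling2_exists lam r : exists S, is_lrstirling2 lam r S.
Proof.
exists (fun n k => gffact_coord lam r%:R (n - r) (k - r)) => n.
by rewrite (gffact_coordP lam); apply: eq_bigr => k _; rewrite !addnK.
Qed.

Lemma lrstirling2_uniq lam r S S' :
    is_lrstirling2 lam r S -> is_lrstirling2 lam r S' ->
  forall n k, (k <= n)%N -> S (n + r)%N (k + r)%N = S' (n + r)%N (k + r)%N.
Proof.
move=> SP S'P n k kn; apply/eqP; rewrite -subr_eq0; apply/eqP.
apply: (@gffact_free lam n.+1
  (fun k => S (n + r)%N (k + r)%N - S' (n + r)%N (k + r)%N)) => //.
under eq_bigr do rewrite scalerBl.
by rewrite sumrB -SP -S'P subrr.
Qed.

Lemma lstirling2E lam S : is_lstirling2 lam S <-> is_lrstirling2 lam 0 S.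
Proof.
by split=> SP n; move: (SP n); rewrite addr0 => ->;
  apply: eq_bigr => k _; rewrite !addn0.
Qed.
End GeneralizedFallingFactorial.

(* Formal power series over a field, as coefficient sequences compared by [=1]. *)
Section FormalPowerSeries.
Variable F : fieldType.
Implicit Types (f g : nat -> F) (m n : nat) (x : F).

Definition fps_one : nat -> F := fun n => (n == 0%N)%:R.

Definition fps_t : nat -> F := fun n => (n == 1%N)%:R.

Definition fps_sub f g : nat -> F := fun n => f n - g n.

Definition fps_mul f g : nat -> F := fun n => \sum_(i < n.+1) f i * g (n - i)%N.

Definition fps_pow f m : nat -> F := iter m (fps_mul f) fps_one.

(* the coefficients of degree < n of 1/f, assuming f 0 != 0 *)
Fixpoint fps_inv_seq f n : seq F :=
  if n is n'.+1 then
    let s := fps_inv_seq f n' in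
    rcons s ((f 0%N)^-1 * ((n' == 0%N)%:R - \sum_(i < n') f (n' - i)%N * s`_i))
  else [::].

Definition fps_inv f : nat -> F := fun n => (fps_inv_seq f n.+1)`_n.

(* f / t, for f without constant term *)
Definition fps_divt f : nat -> F := fun n => f n.+1.

(* e^{x t} *)
Definition fps_exp x : nat -> F := fun n => x ^+ n / n`!%:R.

(* t / (e^t - 1), computed as 1 / ((e^t - 1) / t) *)
Definition fps_bernoulli : nat -> F :=
  fps_inv (fps_divt (fps_sub (fps_exp 1) fps_one)).

(* B_n^{(m)}(x) is n! times the coefficient of t^n in (t/(e^t-1))^m e^{x t}. *)
Definition ho_bernoulli m n x : F :=
  n`!%:R * fps_mul (fps_pow fps_bernoulli m) (fps_exp x) n.

Lemma size_fps_inv_seq f n : size (fps_inv_seq f n) = n.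
Proof. by elim: n => //= n IHn; rewrite size_rcons IHn. Qed.

Lemma nth_fps_inv_seq f n i : (i < n)%N -> (fps_inv_seq f n)`_i = fps_inv f i.
Proof.
elim: n => // n IHn; rewrite ltnS leq_eqVlt => /orP[/eqP->//|lt_in].
by rewrite /= nth_rcons size_fps_inv_seq lt_in IHn.
Qed.

Lemma fps_mulV f : f 0%N != 0 -> fps_mul f (fps_inv f) =1 fps_one.
Proof.
move=> f0 n; rewrite /fps_mul (reindex_inj rev_ord_inj) /=.
rewrite big_ord_recr /= subSS subnn subn0.
under eq_bigr => i _ do rewrite subSS subKn ?(ltnW (ltn_ord i)) //.
rewrite {2}/fps_inv /= nth_rcons size_fps_inv_seq ltnn eqxx.
rewrite mulrA divff // mul1r addrC.
under [X in _ - X]eq_bigr => i _ do rewrite nth_fps_inv_seq //.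
by rewrite subrK.
Qed.

Lemma fps_bernoulliP :
  fps_mul (fps_sub (fps_exp 1) fps_one) fps_bernoulli =1 fps_t.
Proof.
move=> n; rewrite /fps_mul big_ord_recl {1}/fps_sub /fps_exp /fps_one /=.
rewrite expr0 fact0 divr1 subrr mul0r add0r.
case: n => [|n]; first by rewrite big_ord0.
under eq_bigr => i _ do rewrite subSS.
apply: (fps_mulV (f := fps_divt (fps_sub (fps_exp 1) fps_one))).
by rewrite /fps_divt /fps_sub /fps_exp /fps_one subr0 expr1n divr1 oner_neq0.
Qed.

End FormalPowerSeries.

(* Main.v *)
Require Import Defs.
From HB Require Import structures.
From mathcomp Require Import all_boot all_order all_algebra.
From mathcomp Require Import ring.
From mathcomp Require Import boolp reals.
Set Implicit Arguments.
Unset Strict Implicit.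
Unset Printing Implicit Defensive.
Import Order.TTheory GRing.Theory Num.Theory.
Local Open Scope ring_scope.

(** Put D(t) = (e^(lam t) - 1) / lam, so that D' = lam D + 1. Then D^k e^(ct)
satisfies the differential form of the recurrence for the coordinates of
(x + c)^n in the basis (x)_{k,lam}, whence
  sum_n {n+r brace k+r}_{r,lam} t^n / n! = D^k e^(rt) / k!.
Since B(lam t) = t / D(t), where B(t) = t / (e^t - 1), the product of the series
sum_l {l+m brace k+m}_lam t^(l+m) / (l+m)! = D^(k+m) / (k+m)! with
B(lam t)^m e^(rt) is t^m D^k e^(rt) / (k+m)!; the identity compares the
coefficients of t^(n+m). *)

(** * The commutative ring of formal power series under the Cauchy product *)

Definition fps (F : fieldType) : Type := nat -> F.

Section PowerSeriesRing.
Variable F : fieldType.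
Implicit Types f g h : fps F.

(** Classical equality and choice, with [funext], make series a ring for Leibniz equality, so that
    [ring] applies to them. *)
HB.instance Definition _ := gen_eqMixin (fps F).
HB.instance Definition _ := gen_choiceMixin (fps F).

Let add f g : fps F := fun n => f n + g n.
Let opp f : fps F := fun n => - f n.
Let zero : fps F := fun=> 0.

Fact fps_addA : associative add.
Proof. by move=> f g h; apply/funext => n; rewrite /add addrA. Qed.
Fact fps_addC : commutative add.
Proof. by move=> f g; apply/funext => n; rewrite /add addrC. Qed.
Fact fps_add0 : left_id zero add.
Proof. by move=> f; apply/funext => n; rewrite /add add0r. Qed.
Fact fps_addN : left_inverse zero opp add.
Proof. by move=> f; apply/funext => n; rewrite /add addNr. Qed.

HB.instance Definition _ :=
  GRing.isZmodule.Build (fps F) fps_addA fps_addC fps_add0 fps_addN.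

Definition fps_trunc N f : {poly F} := \poly_(i < N) f i.

(** Through truncations, commutativity and associativity are inherited from polynomials. *)
Lemma fps_mul_trunc N f g n : (n < N)%N ->
  fps_mul f g n = (fps_trunc N f * fps_trunc N g)`_n.
Proof.
move=> nN; rewrite coefM; apply: eq_bigr => i _; rewrite !coef_poly.
by rewrite (leq_ltn_trans (leq_ord i)) ?(leq_ltn_trans (leq_subr _ _)).
Qed.

Let mul f g : fps F := fps_mul f g.
Let one : fps F := @fps_one F.

Fact fps_mulC : commutative mul.
Proof.
by move=> f g; apply/funext => n; rewrite /mul !(@fps_mul_trunc n.+1) // mulrC.
Qed.

Fact fps_mulA : associative mul.
Proof.
move=> f g h; apply/funext => n; rewrite /mul.
have trunc_mulr u v w :
    fps_mul u (fps_mul v w) n =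
    (fps_trunc n.+1 u * (fps_trunc n.+1 v * fps_trunc n.+1 w))`_n.
  rewrite coefM; apply: eq_bigr => i _.
  by rewrite -fps_mul_trunc ?coef_poly ?ltn_ord // ltnS leq_subr.
(* Commutativity brings the left-nested product to the right-nested shape that [trunc_mulr]
   covers. *)
rewrite -[RHS]/(mul (mul f g) h n) fps_mulC /mul !trunc_mulr.
by rewrite mulrA [in RHS]mulrC.
Qed.

Fact fps_mul1 : left_id one mul.
Proof.
move=> f; apply/funext => n; rewrite /mul /fps_mul big_ord_recl /= subn0.
by rewrite mul1r big1 ?addr0 // => i _; rewrite /one /fps_one /= mul0r.
Qed.

Fact fps_mulD : left_distributive mul add.
Proof.
move=> f g h; apply/funext => n; rewrite /mul /add /fps_mul -big_split.
by apply: eq_bigr => i _; rewrite mulrDl.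
Qed.

Fact fps_one_neq0 : one != zero.
Proof.
by apply/eqP => /(congr1 (@^~ 0%N)) /eqP; rewrite /one /fps_one oner_eq0.
Qed.

HB.instance Definition _ := GRing.Zmodule_isComNzRing.Build (fps F)
  fps_mulA fps_mulC fps_mul1 fps_mulD fps_one_neq0.

Lemma fps_addE f g n : (f + g) n = f n + g n. Proof. by []. Qed.

Lemma fps_mulE f g n : (f * g) n = \sum_(i < n.+1) f i * g (n - i)%N.
Proof. by []. Qed.

Lemma fps_powE f m : fps_pow f m = f ^+ m.
Proof. by elim: m => //= m IHm; rewrite exprS -IHm. Qed.

Definition fpsC (c : F) : fps F := fun n => if n is 0%N then c else 0.

Lemma fpsC_mulE c f n : (fpsC c * f) n = c * f n.
Proof.
rewrite fps_mulE big_ord_recl subn0 big1 ?addr0 // => i _.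
by rewrite mul0r.
Qed.

Lemma fps_natrM k f n : (k%:R * f) n = k%:R * f n.
Proof.
rewrite !mulr_natl; elim: k => // k IHk.
by rewrite !mulrS fps_addE IHk.
Qed.

Lemma fps_tS_mul f n : ((fps_t F : fps F) * f) n.+1 = f n.
Proof.
rewrite fps_mulE 2!big_ord_recl /fps_t /= mul0r mul1r add0r subSS subn0.
by rewrite big1 ?addr0 // => i _; rewrite mul0r.
Qed.

Lemma fps_t0_mul f : ((fps_t F : fps F) * f) 0%N = 0.
Proof. by rewrite fps_mulE big_ord1 mul0r. Qed.

(** Used from right to left, this cancels t^m in an equation between series. *)
Lemma fps_tXn_mul m f n : ((fps_t F : fps F) ^+ m * f) (n + m)%N = f n.
Proof.
by elim: m => [|m IHm]; rewrite ?addn0 ?mul1r // addnS exprS -mulrA fps_tS_mul.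
Qed.

Lemma fps_tXn_mul_lt m f n : (n < m)%N -> ((fps_t F : fps F) ^+ m * f) n = 0.
Proof.
elim: m n => // m IHm [|n] nm; rewrite exprS -mulrA ?fps_t0_mul //.
by rewrite fps_tS_mul IHm.
Qed.

(** * Formal derivative and the substitution of c t for t *)

Definition fps_deriv f : fps F := fun n => n.+1%:R * f n.+1.

Lemma fps_derivM f g : fps_deriv (f * g) = fps_deriv f * g + f * fps_deriv g.
Proof.
apply/funext => n; rewrite fps_addE {1}/fps_deriv !fps_mulE mulr_sumr.
(* The weight n + 1 splits as i + (n + 1 - i); each half then loses the boundary term whose weight
   is 0. *)
transitivity (\sum_(i < n.+2) i%:R * f i * g (n.+1 - i)%N +
              \sum_(i < n.+2) f i * ((n.+1 - i)%:R * g (n.+1 - i)%N)).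
  rewrite -big_split; apply: eq_bigr => i _ /=.
  by rewrite natrB ?leq_ord //; ring.
congr (_ + _).
  by rewrite big_ord_recl !mul0r add0r; apply: eq_bigr => i _; rewrite subSS.
rewrite big_ord_recr /= subnn mul0r mulr0 addr0.
by apply: eq_bigr => i _; rewrite /fps_deriv subSn ?leq_ord.
Qed.

Lemma fps_derivX f k : fps_deriv (f ^+ k.+1) = k.+1%:R * f ^+ k * fps_deriv f.
Proof.
elim: k => [|k IHk]; first by rewrite expr1 expr0 !mul1r.
by rewrite exprS fps_derivM IHk [f ^+ k.+1]exprS -[k.+2%:R]natr1; ring.
Qed.

(* f (c t) *)
Definition fps_rescale (c : F) f : fps F := fun n => c ^+ n * f n.

Lemma fps_rescaleM c f g :
  fps_rescale c (f * g) = fps_rescale c f * fps_rescale c g.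
Proof.
apply/funext => n; rewrite /fps_rescale !fps_mulE mulr_sumr.
apply: eq_bigr => i _.
have -> : c ^+ n = c ^+ i * c ^+ (n - i) by rewrite -exprD subnKC ?leq_ord.
ring.
Qed.

Lemma fps_rescaleX c f m : fps_rescale c (f ^+ m) = fps_rescale c f ^+ m.
Proof.
elim: m => [|m IHm]; last by rewrite !exprS fps_rescaleM IHm.
by apply/funext => -[|n]; rewrite /fps_rescale ?mulr1 ?mulr0.
Qed.

End PowerSeriesRing.

(** * Generating functions of the coordinates and of the Bernoulli polynomials *)

Section GeneratingFunctions.
Variables (F : numFieldType) (lam : F).
Hypothesis lam_neq0 : lam != 0.

(* the series D *)
Definition fps_lexpm1 : fps F :=
  fun n => fps_sub (fps_exp lam) (fps_one F) n / lam.

Lemma factS_neq0 n : n`!%:R != 0 :> F.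
Proof. by rewrite pnatr_eq0 -lt0n fact_gt0. Qed.

Lemma fps_deriv_exp (c : F) : fps_deriv (fps_exp c) = fpsC c * fps_exp c.
Proof.
apply/funext => n; rewrite fpsC_mulE /fps_deriv /fps_exp factS natrM exprS.
by field; rewrite factS_neq0 addrC natr1 pnatr_eq0.
Qed.

Lemma fps_exp0 : fps_exp 0 = 1 :> fps F.
Proof.
apply/funext => -[|n]; first by rewrite /fps_exp divr1.
by rewrite /fps_exp expr0n mul0r.
Qed.

Lemma fps_deriv_lexpm1 : fps_deriv fps_lexpm1 = fpsC lam * fps_lexpm1 + 1.
Proof.
apply/funext => n; rewrite fps_addE fpsC_mulE.
rewrite /fps_deriv /fps_lexpm1 /fps_sub /= subr0 mulrA.
rewrite -/(fps_deriv (fps_exp lam) n) fps_deriv_exp fpsC_mulE.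
have -> : (1 : fps F) n = fps_one F n by [].
by field.
Qed.

(** Product rule for D^k e^(ct), with D' = lam D + 1. At k = 0 the value of [k.-1] is harmless,
    since the factor k vanishes. *)
Lemma fps_deriv_lexpm1_exp (c : F) k n :
  n.+1%:R * (fps_lexpm1 ^+ k * fps_exp c) n.+1 =
  k%:R * (fps_lexpm1 ^+ k.-1 * fps_exp c) n
    + (c + k%:R * lam) * (fps_lexpm1 ^+ k * fps_exp c) n.
Proof.
set e : fps F := fps_exp c.
rewrite -/(fps_deriv (fps_lexpm1 ^+ k * e) n).
case: k => [|k].
  by rewrite expr0 !mul1r fps_deriv_exp fpsC_mulE !mul0r add0r addr0.
rewrite fps_derivM fps_derivX fps_deriv_lexpm1 fps_deriv_exp /=.
have -> : k.+1%:R * fps_lexpm1 ^+ k * (fpsC lam * fps_lexpm1 + 1) * e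
    + fps_lexpm1 ^+ k.+1 * (fpsC c * e)
  = k.+1%:R * (fps_lexpm1 ^+ k * e)
    + k.+1%:R * (fpsC lam * (fps_lexpm1 ^+ k.+1 * e))
    + fpsC c * (fps_lexpm1 ^+ k.+1 * e).
  by rewrite exprS; ring.
by rewrite !fps_addE !fps_natrM !fpsC_mulE; ring.
Qed.

(** Induction on n: by [fps_deriv_lexpm1_exp] both sides obey the same recurrence, as k / k! = 1 /
    (k-1)! for k > 0. *)
Lemma gffact_coord_egf (c : F) n k :
  gffact_coord lam c n k / n`!%:R =
  (fps_lexpm1 ^+ k * fps_exp c) n / k`!%:R.
Proof.
elim: n k => [|n IHn] k.
  rewrite fps_mulE big_ord1 /= divr1 /fps_exp expr0 divr1 mulr1.
  case: k => [|k]; first by rewrite divr1.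
  (* D has no constant term, hence neither has a positive power of it. *)
  by rewrite exprS fps_mulE big_ord1 /fps_lexpm1 /fps_sub /fps_exp
             expr0 divr1 subrr !mul0r.
have nS : n.+1%:R != 0 :> F by rewrite pnatr_eq0.
apply: (mulfI nS); rewrite [in RHS]mulrA fps_deriv_lexpm1_exp.
have -> : n.+1%:R * (gffact_coord lam c n.+1 k / n.+1`!%:R) =
          gffact_coord lam c n.+1 k / n`!%:R.
  by rewrite factS natrM; field; rewrite factS_neq0 addrC natr1.
rewrite /= [LHS]mulrDl [RHS]mulrDl; congr (_ + _); last first.
  by rewrite -[LHS]mulrA IHn mulrA.
case: k => [|k]; first by rewrite !mul0r.
rewrite IHn factS natrM /=.
by field; rewrite factS_neq0 addrC natr1 pnatr_eq0.
Qed.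

(** Substitute s = lam t in (e^s - 1) B(s) = s and divide by lam. *)
Lemma lexpm1_bernoulli :
  fps_lexpm1 * fps_rescale lam (fps_bernoulli F) = fps_t F.
Proof.
set E : fps F := fps_sub (fps_exp 1) (fps_one F).
have -> : fps_lexpm1 = fpsC lam^-1 * fps_rescale lam E.
  apply/funext => n; rewrite fpsC_mulE mulrC; congr (_ / _).
  rewrite /fps_rescale /E /fps_sub /fps_exp expr1n mulrBr mulrA mulr1.
  by case: n => [|n]; rewrite ?mul1r ?mulr0.
rewrite -mulrA -fps_rescaleM.
have -> : E * fps_bernoulli F = fps_t F by apply/funext/fps_bernoulliP.
apply/funext => n; rewrite fpsC_mulE /fps_rescale /fps_t.
by case: n => [|[|n]]; rewrite ?mulr0 // expr1 mulr1 mulVf.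
Qed.

(** The power of lam is absorbed by the substitution of lam t for t, which turns e^(xt/lam) into
    e^(xt). *)
Lemma ho_bernoulli_rescale m n (x : F) :
  ho_bernoulli m n (x / lam) * lam ^+ n =
  n`!%:R * (fps_rescale lam (fps_bernoulli F) ^+ m * fps_exp x) n.
Proof.
rewrite /ho_bernoulli fps_powE -mulrA; congr (_ * _).
have -> : fps_exp x = fps_rescale lam (fps_exp (x / lam)).
  apply/funext => i; rewrite /fps_rescale /fps_exp expr_div_n.
  by rewrite mulrA [lam ^+ i * _]mulrC divfK // expf_neq0.
by rewrite -fps_rescaleX -fps_rescaleM mulrC.
Qed.

Lemma gffact_coord_bernoulli (c : F) m n k : (k <= n)%N ->
  gffact_coord lam c n k / 'C(k + m, k)%:R =
  \sum_(k <= l < n.+1)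
    'C(n, l)%:R / 'C(l + m, l)%:R * gffact_coord lam 0 (l + m) (k + m)
      * ho_bernoulli m (n - l) (c / lam) * lam ^+ (n - l).
Proof.
move=> kn.
set Bm : fps F := fps_rescale lam (fps_bernoulli F) ^+ m * fps_exp c.
pose A : fps F := fun l => gffact_coord lam 0 (l + m) (k + m) / (l + m)`!%:R.
have tA : (fps_t F : fps F) ^+ m * A =
    fpsC (k + m)`!%:R^-1 * fps_lexpm1 ^+ (k + m).
  apply/funext => j; rewrite fpsC_mulE; case: (leqP m j) => [mj | jm].
    rewrite -(subnK mj) fps_tXn_mul /A gffact_coord_egf mulrC.
    by rewrite fps_exp0 mulr1.
  (* In degree j < m both sides vanish, because D^(k+m) starts in degree k + m. *)
  rewrite fps_tXn_mul_lt // -[fps_lexpm1 ^+ _]mulr1 -fps_exp0.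
  rewrite mulrC -gffact_coord_egf gffact_coord_gt ?mul0r //.
  by apply: leq_trans jm _; apply: leq_addl.
have AB : (A * Bm) n = (fps_lexpm1 ^+ k * fps_exp c) n / (k + m)`!%:R.
  set e : fps F := fps_exp c.
  suff tAB : (fps_t F : fps F) ^+ m * (A * Bm) =
      (fps_t F : fps F) ^+ m * (fpsC (k + m)`!%:R^-1 * (fps_lexpm1 ^+ k * e)).
    by rewrite [RHS]mulrC -fpsC_mulE -[LHS](fps_tXn_mul m) tAB fps_tXn_mul.
  (* Writing t as D(t) B(lam t) makes both sides the same monomial in D, B(lam t) and e^(ct), up to
     the constant. *)
  rewrite mulrA tA /Bm -/e -lexpm1_bernoulli exprMn exprD.
  by set b := fps_rescale _ _; ring.
have binE i : 'C(i + m, i)%:R = (i + m)`!%:R / (i`!%:R * m`!%:R) :> F.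
  rewrite -(bin_fact (leq_addr m i)) addKn !natrM.
  by rewrite mulfK // mulf_neq0 ?factS_neq0.
(* The factor n! m! comes from C(n,l) / C(l+m,l) = n! m! / ((n-l)! (l+m)!). *)
transitivity (n`!%:R * m`!%:R * (A * Bm) n).
  rewrite AB -[gffact_coord _ _ _ _](divfK (factS_neq0 n)).
  rewrite gffact_coord_egf binE.
  by field; rewrite ?factS_neq0.
rewrite fps_mulE mulr_sumr.
rewrite -(big_mkord xpredT (fun i => _ * (A i * Bm (n - i)%N))).
(* The Cauchy product starts at l = 0, but its terms with l < k vanish. *)
rewrite (big_cat_nat (n := k)) ?(leqW kn) //= big_nat_cond big1 ?add0r; last first.
  move=> i /andP[/andP[_ ik] _].
  by rewrite /A gffact_coord_gt ?ltn_add2r // !mul0r mulr0.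
apply: eq_big_nat => l /andP[kl]; rewrite ltnS => ln.
rewrite -[RHS]mulrA ho_bernoulli_rescale -/Bm binE /A.
rewrite -(bin_fact ln) !natrM.
by field; rewrite ?factS_neq0.
Qed.

End GeneratingFunctions.

Theorem theorem7 (R : realType) (lam : R) (r m : nat)
    (S Sr : nat -> nat -> R) :
  lam != 0 -> (1 <= m)%N ->
  is_lstirling2 lam S -> is_lrstirling2 lam r Sr ->
  forall n k : nat, (k <= n)%N ->
    Sr (n + r)%N (k + r)%N / 'C(k + m, k)%:R =
    \sum_(k <= l < n.+1)
      'C(n, l)%:R / 'C(l + m, l)%:R * S (l + m)%N (k + m)%N
        * ho_bernoulli m (n - l) (r%:R / lam) * lam ^+ (n - l).
Proof.
move=> lam_neq0 _ SP SrP n k kn.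
(* The explicit coordinates solve the defining identities for every shift q; uniqueness then
   replaces [Sr] (q = r) and [S] (q = 0) by them. *)
have coordP q : is_lrstirling2 lam q
    (fun n k => gffact_coord lam q%:R (n - q) (k - q)).
  move=> i; rewrite (gffact_coordP lam).
  by apply: eq_bigr => j _; rewrite !addnK.
rewrite (lrstirling2_uniq SrP (coordP r)) // !addnK gffact_coord_bernoulli //.
apply: eq_big_nat => l /andP[kl _]; do 3!congr (_ * _).
move/lstirling2E: SP => SP.
have := lrstirling2_uniq SP (coordP 0%N) (n := l + m) (k := k + m).
by rewrite leq_add2r !addn0 !subn0 => ->.
Qed.
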